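(* Let $E$ be a real normed space. Then the following statements are equivalent to each other: (1) $E$ is finite-dimensional. (2) For each proper l.s.c. function $f: E\to(-\infty,+\infty]$ such that $f$ has a bounded minimizing sequence, there exists $x_0\in E$ such that $f(x_0)=\inf_{x\in E}f(x)$. (3) For each bounded nonempty closed subset $A$ of $E$ and each proper l.s.c. function $f: A\to(-\infty,+\infty]$, there exists $x_0\in A$ such that $f(x_0)=\inf_{x\in A}f(x)$. (4) For each unbounded closed subset $A$ of $E$ and each proper coercive l.s.c. function $f: A\to(-\infty,+\infty]$, there exists $x_0\in A$ such that $f(x_0)=\inf_{x\in A}f(x)$. (5) For each unbounded closed subset $A$ of $E$ and each coercive l.s.c. function $f: A\to(-\infty,+\infty)$, there exists $x_0\in A$ such that $f(x_0)=\inf_{x\in A}f(x)$. (6) For each proper l.s.c. function $f: E\to(-\infty,+\infty]$ satisfying $f(x)\geq\varphi(\|x\|)+\beta$ for any $x\in E$, for some real number $\beta$ and some nondecreasing function $\varphi:[0,+\infty)\to[0,+\infty)$ with $\lim_{t\to+\infty}\varphi(t)=+\infty$, there exists $x_0\in E$ such that $f(x_0)=\inf_{x\in E}f(x)$. (7) For each unbounded closed subset $A$ of $E$ and each bounded coercive l.s.c. function $f: A\to(-\infty,+\infty)$, there exists $x_0\in A$ such that $f(x_0)=\inf_{x\in A}f(x)$. (8) For each coercive Lipschitz function $f: E\to(-\infty,+\infty)$, there exists $x_0\in E$ such that $f(x_0)=\inf_{x\in E}f(x)$. (9) For each bounded closed nonempty subset $A$ of $E$ and each continuous real-valued function $f$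 on $A$, there exists $x_0\in A$ such that $f(x_0)=\inf_{x\in A}f(x)$. (10) For each nonempty bounded closed subset $A$ of $E$ and each continuous real-valued function $f$ defined on $A$ such that $f$ is bounded below, there exists $x_0\in A$ such that $f(x_0)=\inf_{x\in A}f(x)$.
   Context: All normed spaces are over $\mathbb{R}$. Let $A$ be a nonempty subset of a normed space $(E,\|\cdot\|)$ and $f: A\to(-\infty,+\infty]$ a function. - $f$ is proper if $f(x_0)<+\infty$ for some $x_0\in A$. - $f$ is bounded if $f(D)$ is a bounded subset of $\mathbb{R}$ for each bounded subset $D$ of $A$ (so $f$ is real-valued); this does not mean $\sup_{x\in A}|f(x)|<+\infty$. - $f$ is bounded below (on $A$) if $-\infty<\inf\{f(x):x\in A\}<+\infty$. - $f$ is l.s.c. (lower semicontinuous) if $\liminf_n f(x_n)\geq f(x)$ for every $x\in A$ and every sequence $(x_n)$ in $A$ with $\|x_n-x\|\to0$. - $f$ is coercive if $A$ is unbounded and $f(x)\to+\infty$ as $\|x\|\to+\infty$, $x\in A$. - A sequence $(x_n)_{n\in\mathbb{N}}$ in $A$ is a minimizing sequence of $f$ if $(f(x_n))_{n\in\mathbb{N}}$ converges to $\inf_{x\in A}f(x)$ in a nonincreasing manner. *)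

(* Defs.v *)
From HB Require Import structures.
From mathcomp Require Import all_boot all_order all_algebra.
From mathcomp Require Import all_classical all_reals all_analysis.
Set Implicit Arguments.
Unset Strict Implicit.
Unset Printing Implicit Defensive.
Import Order.TTheory GRing.Theory Num.Theory.
Import numFieldNormedType.Exports.
Local Open Scope classical_set_scope.
Local Open Scope ring_scope.

Definition finite_dimensional (R : realType) (E : lmodType R) : Prop :=
  exists (n : nat) (e : 'I_n -> E),
    forall x : E, exists c : 'I_n -> R, x = \sum_(i < n) c i *: e i.

(* A function A -> ]-oo, +oo] is represented by a total function
   f : E -> \bar R subject to [gtNy_on A f]; a function A -> R by a total
   f : E -> R, used as EFin \o f where an extended function is expected.
   The notions below only depend on the values of f on A. *)

Section functions_on_a_subset.
Context {R : realType} {E : normedModType R}.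
Implicit Types (A : set E) (f : E -> \bar R).
Local Open Scope ereal_scope.

Definition gtNy_on A f : Prop := forall x, A x -> -oo < f x.

Definition proper_on A f : Prop := exists2 x0, A x0 & f x0 < +oo.

Definition bounded_on A (f : E -> R) : Prop :=
  forall D : set E, D `<=` A -> bounded_set D -> bounded_set (f @` D).

Definition bounded_below_on A f : Prop :=
  -oo < ereal_inf (f @` A) < +oo.

Definition lsc_on A f : Prop :=
  forall (x : E) (u : nat -> E), A x -> (forall n, A (u n)) ->
    u @ \oo --> x -> f x <= limn_einf (f \o u).

Definition coercive_on A f : Prop :=
  ~ bounded_set A /\
  forall M : R, exists r : R,
    forall x, A x -> (r <= `|x|)%R -> M%:E <= f x.

(* The limit may be -oo. *)
Definition minimizing_seq A f (u : nat -> E) : Prop :=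
  [/\ forall n, A (u n),
      nonincreasing_seq (f \o u) &
      f \o u @ \oo --> ereal_inf (f @` A)].

Definition attains_inf A f : Prop :=
  exists2 x0, A x0 & f x0 = ereal_inf (f @` A).

End functions_on_a_subset.

(* Main.v *)
Require Import Defs.
From HB Require Import structures.
From mathcomp Require Import all_boot all_order all_algebra.
From mathcomp Require Import all_classical all_reals all_analysis lra.
Set Implicit Arguments.
Unset Strict Implicit.
Unset Printing Implicit Defensive.
Import Order.TTheory GRing.Theory Num.Theory.
Import numFieldNormedType.Exports.
Local Open Scope classical_set_scope.
Local Open Scope ring_scope.

(** In finite dimension closed balls are compact, so a bounded minimizing
    sequence has a subsequence that converges, and lower semicontinuity forces
    its limit to be a minimizer ([attains_inf_bounded_seq]).  In every statement
    except the first two, a minimizing sequence is eventually bounded, either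
    because the domain is bounded or because the function is larger than its
    infimum far from the origin: this is [attains_inf_weakly_coercive].

    In infinite dimension a single function refutes all the other statements.
    Riesz's lemma gives unit vectors [u n] at mutual distance at least 1/2
    ([infinite_dim_separated]); put
      f x = inf_n (`|x - u n| + 1 / (n + 2)).
    This function is 1-Lipschitz, is at least `|x| - 1, and takes the value
    1 / (n + 2) at [u n], so that its infimum is 0.  It vanishes nowhere, since
    at most one [u n] is close to a given point.  Its infimum is thus attained
    neither on the whole space nor on the closed unit ball, which both contain
    all the [u n].  The function is coercive, Lipschitz, bounded on bounded
    sets, and has a bounded minimizing sequence, so that it, or its restriction
    to the unit ball, meets the hypotheses of each statement ([finite_dimensional_of_attained]).

    Both directions rest on one fact on the span V of finitely many vectors:
    the intersection of V with each closed ball is compact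
    ([has_compact_balls_lin_span]).  It gives the compactness of balls when V is
    the whole space, and otherwise the closedness of V that Riesz's lemma needs.
    It is proved by adding one vector x at a time: as V is closed, a vector x
    outside V is at a distance d > 0 from V, hence the bound
    d * `|t| <= `|v + t *: x|, which confines t and then v to compact sets. *)

(** * Spans of finitely many vectors and Riesz's lemma *)

Section compact_balls.
Context {R : realType} {E : normedModType R}.
Implicit Types (V A : set E) (x y : E) (r : R).

Definition norm_ball r : set E := [set x | `|x| <= r].

Definition has_compact_balls V : Prop := forall r, compact (V `&` norm_ball r).

Definition is_subspace V : Prop :=
  V 0 /\ forall (a : R) (u v : E), V u -> V v -> V (a *: u + v).

Lemma closed_norm_ball r : closed (norm_ball r).
Proof.
have -> : norm_ball r = closed_ball_ Num.norm 0 r.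
  by apply/seteqP; split=> x; rewrite /norm_ball /closed_ball_ /= sub0r normrN.
exact: closed_closed_ball_.
Qed.

Lemma bounded_norm_ball A r : A `<=` norm_ball r -> bounded_set A.
Proof.
move=> Ar; exists r; split=> [|M rM x /Ar xr]; first exact: num_real.
exact: le_trans xr (ltW rM).
Qed.

Lemma bounded_sub_norm_ball A : bounded_set A -> exists r, A `<=` norm_ball r.
Proof. by case=> M [_ /(_ (M + 1))] AM; exists (M + 1); apply: AM; rewrite ltrDl. Qed.

(** Instead of a strictly increasing extraction, [k] is only asked to satisfy
    [n <= k n]: this is enough for [k] to tend to infinity. *)
Lemma compact_subsequence A (u : nat -> E) :
  compact A -> (forall n, A (u n)) ->
  exists x (k : nat -> nat),
    [/\ A x, forall n, (n <= k n)%N & u \o k @ \oo --> x].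
Proof.
move=> cA Au; have uA : (u @ \oo) A by exists 0%N => // n _; exact: Au.
have [x [Ax clx]] := cA (u @ \oo) _ uA.
have near_x n : exists k, (n <= k)%N /\ `|x - u k| < n.+1%:R^-1.
  have [_ [[k nk <-] xk]] : u @` [set k | (n <= k)%N] `&` ball x n.+1%:R^-1 !=set0.
    apply: clx; last by apply: nbhsx_ballx; rewrite invr_gt0.
    by exists n => // k nk; exists k.
  by exists k; split=> //; move: xk; rewrite -ball_normE.
have [k /all_and2[nk xk]] := choice near_x; exists x, k; split=> //.
apply/cvgrPdist_lt => e e0; near=> n.
apply: lt_trans (xk n) _; near: n.
have /cvgrPdist_lt/(_ _ e0) := @cvg_harmonic R.
by apply: filterS => n; rewrite sub0r normrN /= ger0_norm ?invr_ge0.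
Unshelve. all: by end_near. Qed.

(** Closedness is local: near [x], the set coincides with its intersection with
    the ball of radius [`|x| + 1], which is compact, hence closed. *)
Lemma has_compact_balls_closed V : has_compact_balls V -> closed V.
Proof.
move=> cV x Vx; have /(_ x) := compact_closed (@norm_hausdorff _ E) (cV (`|x| + 1)).
move=> h; suff /h[] : closure (V `&` norm_ball (`|x| + 1)) x by [].
move=> U Ux; have [|y [Vy [Uy xy]]] := Vx (U `&` ball x 1).
  by apply: filterI => //; exact: nbhsx_ballx.
exists y; split=> //; split=> //; rewrite /norm_ball /=.
move: xy; rewrite -ball_normE /= => xy.
rewrite -[y](subrK x) (le_trans (ler_normD _ _)) // addrC lerD2l.
by rewrite distrC ltW.
Qed.

Lemma closed_dist_gt0 A x : closed A -> ~ A x ->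
  exists2 d : R, 0 < d & forall v, A v -> d <= `|x - v|.
Proof.
move=> cA nAx; have : nbhs x (~` A) by apply: open_nbhs_nbhs; split=> //; exact: closed_openC.
move=> /nbhs_ballP[d /= d0 dA]; exists d => // v Av; rewrite leNgt; apply/negP.
by move=> xv; apply: (dA v) => //; rewrite -ball_normE.
Qed.

Definition add_line V x : set E :=
  [set y | exists (t : R) (v : E), V v /\ y = v + t *: x].

Lemma is_subspace_add_line V x : is_subspace V -> is_subspace (add_line V x).
Proof.
move=> [V0 VD]; split; first by exists 0, 0; rewrite scale0r addr0.
move=> a _ _ [t [v [Vv ->]]] [s [w [Vw ->]]].
exists (a * t + s), (a *: v + w); split; first exact: VD.
by rewrite scalerDr scalerA scalerDl addrACA.
Qed.

Lemma is_subspaceZ V a v : is_subspace V -> V v -> V (a *: v).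
Proof. by move=> [V0 VD] Vv; rewrite -[_ *: _]addr0; exact: VD. Qed.

(** If [x] is outside [V], each ball of [V + R x] lies in the image, under
    [(t, v) |-> v + t *: x], of a compact set of pairs, because the positive
    distance from [x] to [V] bounds the coefficient [t], then the vector [v]. *)
Lemma has_compact_balls_add_line V x :
  is_subspace V -> has_compact_balls V -> has_compact_balls (add_line V x).
Proof.
move=> sV cV r; have [Vx|nVx] := pselect (V x).
  suff -> : add_line V x = V by exact: cV.
  apply/seteqP; split=> [_ [t [v [Vv ->]]]|v Vv].
    by rewrite addrC; apply: sV.2.
  by exists 0, v; rewrite scale0r addr0.
have [d d0 dV] := closed_dist_gt0 (has_compact_balls_closed cV) nVx.
(* Dividing by [t] turns [v + t *: x] into the difference of [x] and a vector of
   [V]. *)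
have dist_line t v : V v -> d * `|t| <= `|v + t *: x|.
  move=> Vv; have [->|t0] := eqVneq t 0; first by rewrite normr0 mulr0.
  have -> : v + t *: x = t *: (x - (- t^-1 *: v)).
    by rewrite scalerBr scaleNr scalerN scalerA divff// scale1r opprK addrC.
  by rewrite normrZ mulrC ler_wpM2l// dV//; exact: is_subspaceZ.
pose s := r / d.
pose K := (fun p : R * E => p.2 + p.1 *: x) @`
  (`[- s, s] `*` (V `&` norm_ball (r + s * `|x|))).
have cK : compact K.
  apply: continuous_compact.
    apply: continuous_subspaceT => -[t v]; apply: cvgD; first exact: cvg_snd.
    by apply: cvgZr_tmp; exact: cvg_fst.
  by apply: compact_setX; [exact: segment_compact|exact: cV].
suff -> : add_line V x `&` norm_ball r = K `&` norm_ball r.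
  by apply: compact_closedI => //; exact: closed_norm_ball.
apply/seteqP; split=> [y [[t [v [Vv ->]]] yr]|y [[[t v] [_ [Vv _]] <-] yr]].
  split=> //; exists (t, v) => //=.
  have ts : `|t| <= s.
    by rewrite ler_pdivlMr// mulrC (le_trans (dist_line _ _ Vv)).
  split=> /=; first by rewrite in_itv /= -ler_norml.
  split=> //; rewrite /norm_ball /= -[v](addrK (t *: x)).
  rewrite (le_trans (ler_normB _ _))// lerD// normrZ.
  by rewrite ler_wpM2r.
by split=> //; exists t, v.
Qed.

(** Recursion on the list matches the induction of
    [has_compact_balls_lin_span], which adds one vector at a time. *)
Fixpoint lin_span (s : seq E) : set E :=
  if s is x :: s' then add_line (lin_span s') x else [set 0].

Lemma is_subspace_lin_span s : is_subspace (lin_span s).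
Proof.
elim: s => [|x s IHs] /=; last exact: is_subspace_add_line.
by split=> // a u v -> ->; rewrite scaler0 addr0.
Qed.

Lemma has_compact_balls_lin_span s : has_compact_balls (lin_span s).
Proof.
elim: s => [r|x s IHs] /=.
  by apply: compact_closedI; [exact: compact_set1|exact: closed_norm_ball].
by apply: has_compact_balls_add_line => //; exact: is_subspace_lin_span.
Qed.

Lemma mem_lin_span s x : x \in s -> lin_span s x.
Proof.
elim: s => // y s IHs; rewrite inE => /predU1P[->|/IHs xs] /=.
  exists 1, 0; rewrite add0r scale1r; split=> //.
  by have [] := is_subspace_lin_span s.
by exists 0, x; rewrite scale0r addr0.
Qed.

Lemma finite_dimensional_lin_span :
  finite_dimensional E <-> exists s, lin_span s = setT.
Proof.
split=> [[n [e espan]]|[s sT]].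
  exists [seq e i | i <- enum 'I_n]; apply/seteqP; split=> // x _.
  have [c ->] := espan x; rewrite -big_enum /=.
  elim: (enum 'I_n) => [|i l IHl]; first by rewrite big_nil.
  rewrite big_cons /=; exists (c i), (\sum_(j <- l) c j *: e j).
  by rewrite addrC.
exists (size s), (fun i => s`_i).
suff coef x : lin_span s x ->
    exists c : nat -> R, x = \sum_(i < size s) c i *: s`_i.
  move=> x; have [|c ->] := coef x; first by rewrite sT.
  by exists (fun i => c i).
elim: s x {sT} => [x ->|y s IHs _ /= [t [v [/IHs[c ->] ->]]]] /=.
  by exists (fun=> 0); rewrite big_ord0.
exists (fun i => if i is j.+1 then c j else t).
by rewrite big_ord_recl /= addrC.
Qed.

Lemma finite_dimensional_compact r :
  finite_dimensional E -> compact (norm_ball r).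
Proof.
move=> /finite_dimensional_lin_span[s sT].
by have := @has_compact_balls_lin_span s r; rewrite sT setTI.
Qed.

(** Take [y] outside [V] and [v] in [V] whose distance to [y] is less than twice
    the distance from [y] to [V]; the normalization of [y - v] is the vector
    sought. *)
Lemma riesz_lemma V : is_subspace V -> closed V -> V <> setT ->
  exists2 x, `|x| = 1 & forall v, V v -> 2^-1 <= `|x - v|.
Proof.
move=> sV cV VT.
have [y nVy] : exists y, ~ V y.
  by apply/existsNP => Vall; apply: VT; apply/seteqP; split.
have [d d0 dV] := closed_dist_gt0 cV nVy.
pose D := [set `|y - v| | v in V].
have D0 : D !=set0 by exists `|y - 0|, 0 => //; exact: sV.1.
have dD : d <= inf D by apply: lb_le_inf => // _ [v Vv <-]; exact: dV.
have infD0 : 0 < inf D := lt_le_trans d0 dD.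
have hD : has_inf D by split=> //; exists d => _ [v Vv <-]; exact: dV.
have [_ [v Vv <-] yv] := inf_adherent infD0 hD.
have yv0 : 0 < `|y - v| := lt_le_trans d0 (dV _ Vv).
exists (`|y - v|^-1 *: (y - v)).
  by rewrite normrZ normrV ?unitfE ?gt_eqF// normr_id mulVf// gt_eqF.
move=> w Vw.
have -> : `|y - v|^-1 *: (y - v) - w =
    `|y - v|^-1 *: (y - (`|y - v| *: w + v)).
  rewrite opprD addrA addrAC [RHS]scalerBr scalerA mulVf ?gt_eqF// scale1r.
  by [].
rewrite normrZ normrV ?unitfE ?gt_eqF// normr_id mulrC ler_pdivlMr//.
have : inf D <= `|y - (`|y - v| *: w + v)|.
  by apply: ge_inf; [exact: hD.2|exists (`|y - v| *: w + v) => //; exact: sV.2].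
apply: le_trans; rewrite mulrC ler_pdivrMr// mulr_natr mulr2n; exact: ltW.
Qed.

(** Each vector is given by Riesz's lemma applied to the span of the previous
    ones, which is closed and never the whole space. *)
Lemma infinite_dim_separated : ~ finite_dimensional E ->
  exists x : nat -> E, (forall n, `|x n| = 1) /\
    forall m n, m != n -> 2^-1 <= `|x m - x n|.
Proof.
move=> nfd.
have /choice[g gP] (s : seq E) :
    exists x, `|x| = 1 /\ forall v, lin_span s v -> 2^-1 <= `|x - v|.
  have [||sT|x x1 xs] := @riesz_lemma (lin_span s); last by exists x.
  - exact: is_subspace_lin_span.
  - by apply: has_compact_balls_closed; exact: has_compact_balls_lin_span.
  - by apply: nfd; apply/finite_dimensional_lin_span; exists s.
(* [h n] lists the first [n] vectors. *)
pose h := fix h n : seq E := if n is m.+1 then g (h m) :: h m else [::].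
have hsub m n : (m < n)%N -> g (h m) \in h n.
  elim: n => // n IHn; rewrite ltnS leq_eqVlt => /predU1P[->|/IHn] /=.
    by rewrite inE eqxx.
  by rewrite inE orbC => ->.
exists (g \o h); split=> [n|m n]; first exact: (gP _).1.
rewrite neq_ltn => /orP[] mn; last exact/(gP _).2/mem_lin_span/hsub.
by rewrite distrC; exact/(gP _).2/mem_lin_span/hsub.
Qed.

End compact_balls.

(** * Attainment in finite dimension *)

Section attainment.
Context {R : realType} {E : normedModType R}.
Implicit Types (A : set E).

Lemma lsc_on_continuous A (f : E -> R) :
  {within A, continuous f} -> lsc_on A (EFin \o f).
Proof.
move=> /subspace_continuousP cf x u Ax Au ux.
suff /cvg_limn_einf_sup[-> _] : (EFin \o f) \o u @ \oo --> (f x)%:E by [].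
apply: cvg_EFin; first exact: nearW.
apply: (cvg_comp u f _ (cf x Ax)).
by move=> U /= /ux[N _ NU]; exists N => // n /NU; apply.
Qed.

Lemma lipschitz_continuous (f : E -> R) : lipschitz f -> continuous f.
Proof.
move=> /pinfty_ex_gt0[M M0 fM] x; apply/cvgrPdist_lt => e e0.
near=> y; apply: le_lt_trans (fM (x, y) _) _ => //=.
rewrite mulrC -ltr_pdivlMr//; near: y.
by apply: cvgr_dist_lt => //; exact: divr_gt0.
Unshelve. all: by end_near. Qed.

Lemma lipschitz_bounded_on A (f : E -> R) : lipschitz f -> bounded_on A f.
Proof.
move=> /pinfty_ex_gt0[M M0 fM] D _ /bounded_sub_norm_ball[r Dr].
exists (`|f 0| + M * r); split=> [|c rc _ [x /Dr xr <-]]; first exact: num_real.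
have := fM (x, 0) (conj I I); rewrite /= subr0 => fx.
apply: le_trans (ltW rc); rewrite -[f x](subrK (f 0)) addrC.
apply: le_trans (ler_normD _ _) _; rewrite lerD2l.
by apply: le_trans fx _; rewrite ler_pM2l.
Qed.

Lemma unbounded_nonempty A : ~ bounded_set A -> A !=set0.
Proof.
move=> nA; apply/set0P/negP => /eqP A0; apply: nA; rewrite A0.
by apply: (@bounded_norm_ball _ _ _ 0) => x [].
Qed.

Lemma gtNy_on_EFin A (f : E -> R) : gtNy_on A (EFin \o f).
Proof. by move=> x _; exact: ltNyr. Qed.

Lemma proper_on_EFin A (f : E -> R) : A !=set0 -> proper_on A (EFin \o f).
Proof. by move=> [x Ax]; exists x => //; exact: ltry. Qed.

Local Open Scope ereal_scope.

(** A cluster point of the sequence lies in [A], and its value is at most the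
    limit inferior of the values along a subsequence that converges to it, which
    is the infimum. *)
Lemma attains_inf_bounded_seq A (f : E -> \bar R) (u : nat -> E) :
  finite_dimensional E -> closed A -> lsc_on A f ->
  (forall n, A (u n)) -> bounded_set (range u) ->
  f \o u @ \oo --> ereal_inf (f @` A) -> attains_inf A f.
Proof.
move=> fd cA fA Au /bounded_sub_norm_ball[r ur] uf.
have cK := compact_closedI (finite_dimensional_compact (r := r) fd) cA.
have [|x [k [[_ Ax] nk ukx]]] := compact_subsequence cK (u := u).
  by move=> n; split=> //; apply: ur; exists n.
exists x => //; apply/eqP; rewrite eq_le; apply/andP; split; last first.
  by apply: ereal_inf_lbound; exists x.
apply: le_trans (fA x _ Ax (fun n => Au (k n)) ukx) _.
have kf : f \o (u \o k) @ \oo --> ereal_inf (f @` A).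
  apply: (cvg_comp k (f \o u) _ uf) => U [N _ NU].
  by exists N => // n /= Nn; apply: NU; exact: leq_trans (nk n).
by have [-> _] := cvg_limn_einf_sup kf.
Qed.

(** Unlike [coercive_on], the growth hypothesis allows [A] to be bounded.  It
    makes every sequence of values below a real number [M] come from a bounded
    sequence of points, and such an [M] exists above the infimum because [f] is
    proper. *)
Lemma attains_inf_weakly_coercive A (f : E -> \bar R) :
  finite_dimensional E -> closed A -> lsc_on A f -> proper_on A f ->
  (forall M : R, exists r : R,
    forall x, A x -> (r <= `|x|)%R -> M%:E <= f x) ->
  attains_inf A f.
Proof.
move=> fd cA fA [x0 Ax0 fx0] coer.
have fA0 : f @` A != set0 by apply/set0P; exists (f x0), x0.
have [v vA vinf] := ereal_inf_seq fA0.
have /choice[u uP] n : exists x, A x /\ f x = v n by have [x] := vA n; exists x.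
have inf_lty : ereal_inf (f @` A) < +oo.
  by apply: le_lt_trans fx0; apply: ereal_inf_lbound; exists x0.
have [M infM] : exists M : R, ereal_inf (f @` A) < M%:E.
  case: (ereal_inf _) inf_lty => [s _| |_] //; last by exists 0%R; rewrite ltNyr.
  by exists (s + 1)%R; rewrite lte_fin ltrDl.
have [r rM] := coer M.
have [N _ NM] : \forall n \near \oo, v n < M%:E.
  exact: vinf (open_ereal_lt' infM).
(* The first [N] terms may lie outside the ball of radius [r]. *)
apply: (attains_inf_bounded_seq (u := fun n => u (n + N)%N)) => //.
- by move=> n; exact: (uP _).1.
- apply: (bounded_norm_ball (r := r)) => _ [n _ <-].
  rewrite /norm_ball /= leNgt; apply/negP => rn.
  have := NM _ (leq_addl n N); rewrite /= -(uP _).2 ltNge.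
  by rewrite rM ?ltW//; exact: (uP _).1.
- rewrite -(cvg_shiftn N) in vinf.
  by apply: cvg_trans vinf; under eq_cvg do rewrite /= (uP _).2.
Qed.

Lemma attains_inf_bounded A (f : E -> \bar R) :
  finite_dimensional E -> bounded_set A -> closed A -> lsc_on A f ->
  proper_on A f -> attains_inf A f.
Proof.
move=> fd /bounded_sub_norm_ball[r Ar] cA fl fp.
apply: attains_inf_weakly_coercive => // M; exists (r + 1)%R => x /Ar xr rx.
by have := le_trans rx xr; rewrite gerDl ler10.
Qed.

End attainment.

(** * An unattained infimum in infinite dimension *)

Section unattained_infimum.
Context {R : realType} {E : normedModType R}.
Implicit Types (A : set E) (f : E -> R) (u : nat -> E).

(** The weights [n.+2%:R^-1] tend to 0, so the infimum over the points [u n] is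
    0; they start at 1/2 so as not to exceed the separation of the points. *)
Definition weighted_distance u (x : E) : R :=
  inf (range (fun n => `|x - u n| + n.+2%:R^-1)).

Lemma weighted_distance_le u x n :
  weighted_distance u x <= `|x - u n| + n.+2%:R^-1.
Proof.
by apply: ge_inf; [exists 0 => _ [m _ <-]; rewrite addr_ge0|exists n].
Qed.

Lemma weighted_distance_ge u x c :
  (forall n, c <= `|x - u n| + n.+2%:R^-1) -> c <= weighted_distance u x.
Proof.
move=> cu; apply: lb_le_inf => [|_ [n _ <-]]; last exact: cu.
by exists (`|x - u 0%N| + 2^-1), 0%N.
Qed.

Lemma weighted_distance_lipschitz u : 1.-lipschitz (weighted_distance u).
Proof.
have le x y : weighted_distance u x <= weighted_distance u y + `|x - y|.
  rewrite -lerBlDr; apply: weighted_distance_ge => n.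
  rewrite lerBlDr (le_trans (weighted_distance_le u x n))//.
  by rewrite addrAC lerD2r addrC -[x - u n](subrKA y) ler_normD.
move=> [x y] _ /=; rewrite mul1r ler_distlC lerBlDr le /=.
by rewrite distrC le.
Qed.

(** The properties of the counterexample from which all the others follow. *)
Record unattained f u : Prop := Unattained {
  unattained_lipschitz : 1.-lipschitz f;
  unattained_growth : forall x, `|x| - 1 <= f x;
  unattained_gt0 : forall x, 0 < f x;
  unattained_norm : forall n, `|u n| = 1;
  unattained_seq : forall n, f (u n) = n.+2%:R^-1 }.

(** Positivity at [x] holds because at most one [u m] is within 1/4 of [x]: that
    term is at least its weight, and the others are at least 1/4.  At [u n], the
    term of index [n] is the smallest, since the others are at least 1/2. *)
Lemma infinite_dim_unattained :
  ~ finite_dimensional E -> exists f u, unattained f u.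
Proof.
move=> /infinite_dim_separated[u [u1 usep]].
exists (weighted_distance u), u; split=> // [|x|x|n].
- exact: weighted_distance_lipschitz.
- apply: weighted_distance_ge => n; apply: ler_wpDr => //.
  by rewrite -(u1 n) lerB_dist.
- have [[m xm]|far] := pselect (exists m, `|x - u m| < 4^-1).
    suff : Num.min 4^-1 m.+2%:R^-1 <= weighted_distance u x.
      by apply: lt_le_trans; rewrite lt_min !invr_gt0 !ltr0n.
    apply: weighted_distance_ge => n; rewrite ge_min.
    have [->|nm] := eqVneq n m; first by rewrite lerDr normr_ge0 orbT.
    apply/orP; left; apply: ler_wpDr => //.
    have := le_trans (usep _ _ nm) (ler_distD x (u n) (u m)).
    rewrite [`|u n - x|]distrC; move: xm; lra.
  apply: (@lt_le_trans _ _ 4^-1); first by rewrite invr_gt0.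
  apply: weighted_distance_ge => n; apply: ler_wpDr => //.
  by rewrite leNgt; apply/negP => xn; apply: far; exists n.
- apply/eqP; rewrite eq_le; apply/andP; split.
    by apply: le_trans (weighted_distance_le u _ n) _; rewrite subrr normr0 add0r.
  apply: weighted_distance_ge => m.
  have [->|nm] := eqVneq m n; first by rewrite subrr normr0 add0r.
  rewrite ler_wpDr//; apply: le_trans (usep _ _ _); last by rewrite eq_sym.
  by rewrite lef_pV2 ?posrE ?ltr0n// ler_nat.
Qed.

Section consequences.
Variables (f : E -> R) (u : nat -> E).
Hypothesis fu : unattained f u.

Lemma unattained_is_lipschitz : lipschitz f.
Proof.
apply: klipschitzW (unattained_lipschitz fu).
exact: (globally_properfilter (a := (0, 0))).
Qed.

Lemma unattained_continuous : continuous f.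
Proof. exact: lipschitz_continuous unattained_is_lipschitz. Qed.

Lemma unattained_lsc A : lsc_on A (EFin \o f).
Proof.
exact/lsc_on_continuous/continuous_subspaceT/unattained_continuous.
Qed.

Lemma unattained_cvg : f \o u @ \oo --> 0.
Proof.
have -> : f \o u = (fun n => @harmonic R (n + 1)%N).
  by apply/funext => n; rewrite /= (unattained_seq fu) addn1.
exact: (cvg_comp (fun n => (n + 1)%N) _ (cvg_addnr 1) cvg_harmonic).
Qed.

Lemma unattained_einf A : (forall n, A (u n)) ->
  ereal_inf ((EFin \o f) @` A) = 0%E.
Proof.
move=> Au; apply/eqP; rewrite eq_le; apply/andP; split; last first.
  by apply: le_ereal_inf_tmp => _ [x _ <-]; rewrite lee_fin ltW// (unattained_gt0 fu).
apply/lee_addgt0Pr => e e0; rewrite add0e.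
have /cvgrPdist_lt/(_ _ e0)[N _ /(_ _ (leqnn N))] := unattained_cvg.
rewrite /= sub0r normrN => fe.
apply: (@le_trans _ _ (f (u N))%:E).
  by apply: ereal_inf_lbound; exists (u N).
by rewrite lee_fin ltW// (le_lt_trans (ler_norm _)).
Qed.

Lemma unattained_not_attained A : (forall n, A (u n)) -> ~ attains_inf A (EFin \o f).
Proof.
move=> Au [x _]; rewrite unattained_einf// => -[/eqP].
by rewrite gt_eqF// (unattained_gt0 fu).
Qed.

Lemma unattained_unbounded : ~ bounded_set [set: E].
Proof.
move=> /bounded_sub_norm_ball[r /(_ ((`|r| + 1) *: u 0%N) I)].
rewrite /norm_ball /= normrZ (unattained_norm fu) mulr1 ger0_norm//.
by move: (ler_norm r); lra.
Qed.

Lemma unattained_coercive : coercive_on setT (EFin \o f).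
Proof.
split=> [|M]; first exact: unattained_unbounded.
exists (M + 1) => x _ Mx; rewrite lee_fin.
by apply: le_trans (unattained_growth fu x); rewrite lerBrDr.
Qed.

Lemma unattained_minimizing A : (forall n, A (u n)) ->
  minimizing_seq A (EFin \o f) u.
Proof.
move=> Au; split=> //.
  move=> m n mn; rewrite /= !(unattained_seq fu) lee_fin.
  by rewrite lef_pV2 ?posrE ?ltr0n// ler_nat.
rewrite unattained_einf//; apply: cvg_EFin; first exact: nearW.
exact: unattained_cvg.
Qed.

End consequences.
End unattained_infimum.

(** The form in which the counterexample is used: to deduce finite dimension from
    a statement on attained infima, it suffices to apply that statement to
    [f] on some domain that contains the minimizing sequence. *)
Lemma finite_dimensional_of_attained {R : realType} {E : normedModType R} :
  (forall (f : E -> R) (u : nat -> E), unattained f u ->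
     exists2 A : set E, (forall n, A (u n)) & attains_inf A (EFin \o f)) ->
  finite_dimensional E.
Proof.
move=> attained; apply: contrapT => /infinite_dim_unattained[f [u fu]].
by have [A Au fA] := attained f u fu; exact: (unattained_not_attained fu Au fA).
Qed.

(** * The equivalences *)

Theorem theorem1p9 (R : realType) (E : normedModType R) :
  [<->
    (* (1) *)
    finite_dimensional E;
    (* (2) *)
    forall f : E -> \bar R,
      gtNy_on setT f -> proper_on setT f -> lsc_on setT f ->
      (exists u : nat -> E, minimizing_seq setT f u /\ bounded_set (range u)) ->
      attains_inf setT f;
    (* (3) *)
    forall (A : set E) (f : E -> \bar R),
      bounded_set A -> A !=set0 -> closed A ->
      gtNy_on A f -> proper_on A f -> lsc_on A f ->
      attains_inf A f;
    (* (4) *)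
    forall (A : set E) (f : E -> \bar R),
      ~ bounded_set A -> closed A ->
      gtNy_on A f -> proper_on A f -> coercive_on A f -> lsc_on A f ->
      attains_inf A f;
    (* (5) *)
    forall (A : set E) (f : E -> R),
      ~ bounded_set A -> closed A ->
      coercive_on A (EFin \o f) -> lsc_on A (EFin \o f) ->
      attains_inf A (EFin \o f);
    (* (6) *)
    forall f : E -> \bar R,
      gtNy_on setT f -> proper_on setT f -> lsc_on setT f ->
      (exists (beta : R) (phi : R -> R),
        [/\ forall t, 0 <= t -> 0 <= phi t,
            {in `[0, +oo[ &, {homo phi : s t / s <= t}},
            phi t @[t --> +oo] --> +oo &
            forall x : E, ((phi `|x| + beta)%:E <= f x)%E]) ->
      attains_inf setT f;
    (* (7) *)
    forall (A : set E) (f : E -> R),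
      ~ bounded_set A -> closed A ->
      bounded_on A f -> coercive_on A (EFin \o f) -> lsc_on A (EFin \o f) ->
      attains_inf A (EFin \o f);
    (* (8) *)
    forall f : E -> R,
      coercive_on setT (EFin \o f) -> lipschitz f ->
      attains_inf setT (EFin \o f);
    (* (9) *)
    forall (A : set E) (f : E -> R),
      bounded_set A -> closed A -> A !=set0 ->
      {within A, continuous f} ->
      attains_inf A (EFin \o f);
    (* (10) *)
    forall (A : set E) (f : E -> R),
      A !=set0 -> bounded_set A -> closed A ->
      {within A, continuous f} -> bounded_below_on A (EFin \o f) ->
      attains_inf A (EFin \o f)].
Proof.
tfae.
- move=> fd f _ _ fl [u [[uA _ uf] ub]].
  exact: (attains_inf_bounded_seq (u := u)) => //; exact: closedT.
- move=> h2 A f bA A0 cA _ fp fl.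
  have fd : finite_dimensional E.
    apply: finite_dimensional_of_attained => g u gu; exists setT => //.
    apply: h2; first exact: gtNy_on_EFin.
    + by apply: proper_on_EFin; exists 0.
    + exact: unattained_lsc gu _.
    + exists u; split; first exact: unattained_minimizing.
      apply: (bounded_norm_ball (r := 1)) => _ [n _ <-].
      by rewrite /norm_ball /= (unattained_norm gu).
  exact: attains_inf_bounded.
- move=> h3 A f _ cA _ fp [_ fc] fl.
  apply: attains_inf_weakly_coercive => //.
  apply: finite_dimensional_of_attained => g u gu.
  have u1 n : norm_ball 1 (u n) by rewrite /norm_ball /= (unattained_norm gu).
  have B0 : @norm_ball R E 1 !=set0 by exists (u 0%N).
  exists (norm_ball 1) => //; apply: h3 => //.
  + exact: (bounded_norm_ball (r := 1)).
  + exact: closed_norm_ball.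
  + exact: gtNy_on_EFin.
  + exact: proper_on_EFin.
  + exact: unattained_lsc gu _.
- move=> h4 A f nA cA fc fl; apply: h4 => //; first exact: gtNy_on_EFin.
  exact/proper_on_EFin/unbounded_nonempty.
- move=> h5 f _ fp fl [b [phi [_ _ phioo fphi]]].
  apply: attains_inf_weakly_coercive => //; last first.
    move=> M; have /cvgryPge/(_ (M - b))[r [_ rphi]] := phioo.
    exists (r + 1) => x _ rx; apply: le_trans (fphi x).
    by rewrite lee_fin -lerBlDr; apply: rphi; rewrite (lt_le_trans _ rx)// ltrDl.
  apply: finite_dimensional_of_attained => g u gu; exists setT => //; apply: h5.
  + exact: unattained_unbounded gu.
  + exact: closedT.
  + exact: unattained_coercive gu.
  + exact: unattained_lsc gu _.
- move=> h6 A f nA cA _ [_ fc] fl.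
  apply: attains_inf_weakly_coercive => //; last first.
    exact/proper_on_EFin/unbounded_nonempty.
  apply: finite_dimensional_of_attained => g u gu; exists setT => //; apply: h6.
  + exact: gtNy_on_EFin.
  + by apply: proper_on_EFin; exists 0.
  + exact: unattained_lsc gu _.
  + exists (- 1), id; split=> //.
    by move=> x; rewrite lee_fin (unattained_growth gu).
- move=> h7 f fc fl; apply: h7 => //.
  + exact: fc.1.
  + exact: lipschitz_bounded_on.
  + exact/lsc_on_continuous/continuous_subspaceT/lipschitz_continuous.
- move=> h8 A f bA cA A0 fc.
  have fd : finite_dimensional E.
    apply: finite_dimensional_of_attained => g u gu; exists setT => //.
    apply: h8; first exact: unattained_coercive gu.
    exact: unattained_is_lipschitz gu.
  apply: attains_inf_bounded => //; first exact: lsc_on_continuous.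
  exact: proper_on_EFin.
- by move=> h9 A f A0 bA cA fc _; exact: h9.
- move=> h10; apply: finite_dimensional_of_attained => g u gu.
  have u1 n : norm_ball 1 (u n) by rewrite /norm_ball /= (unattained_norm gu).
  exists (norm_ball 1) => //; apply: h10.
  + by exists (u 0%N).
  + exact: (bounded_norm_ball (r := 1)).
  + exact: closed_norm_ball.
  + exact/continuous_subspaceT/(unattained_continuous gu).
  + by rewrite /bounded_below_on (unattained_einf gu)// ltNyr ltry.
Qed.
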